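(* Let $M$ be a nondegenerate, smooth, cylindrical, ruled surface in $\mathbb{L}^3$, parametrized by $X(s,t)=\gamma(s)+t\,w$, where $w=(1,0,0)$ and $\gamma(s)=(0,x(s),y(s))$ is a curve parametrized by arc length, lying in a plane orthogonal to $w$, i.e. $(x'(s))^2-(y'(s))^2=\delta\in\{-1,1\}$. If $M$ is a homothetic self-similar solution of the inverse mean curvature flow (with constant $C\in\mathbb{R}\setminus\{0\}$), then $$\gamma(s)=\begin{cases}(0,\ r(s)\sinh(t(s)),\ r(s)\cosh(t(s))),&\text{for } f(s)>0,\\ (0,\ r(s)\cosh(t(s)),\ r(s)\sinh(t(s))),&\text{for } f(s)<0,\end{cases}$$ where $$\begin{aligned} f(s)&:=\delta\left(\frac{2}{C}-1\right)s^2+k,\\ t(s)&:=\pm\int\frac{\sqrt{4\delta f(s)+(f'(s))^2}}{2|f(s)|}\,ds=\pm\int\frac{\sqrt{2(2-C)s^2+\delta kC^2}}{|(2-C)s^2+\delta kC|}\,ds,\\ r(s)&:=\pm\sqrt{|f(s)|}, \end{aligned}$$ and $k\in\mathbb{R}$ is a constant. (Here the function $t(s)$ is not the ruling parameter $t$ of $X(s,t)$.)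
   Context: $\mathbb{L}^3$ is $\mathbb{R}^3$ with the metric $\langle x,y\rangle=x_1y_1+x_2y_2-x_3y_3$. The vector product $u\times v$ is defined by $\langle u\times v,x\rangle=\det(x,u,v)$ for all $x$. For $v\in\mathbb{L}^3$, $|v|=\sqrt{|\langle v,v\rangle|}$. For a surface with local parametrization $X(s,t)$ put $E=\langle X_s,X_s\rangle$, $F=\langle X_s,X_t\rangle$, $G=\langle X_t,X_t\rangle$. The surface is nondegenerate if $EG-F^2\neq0$ at all its points. It has unit normals $N=\pm\frac{X_s\times X_t}{|X_s\times X_t|}$, with $\langle N,N\rangle=\epsilon\in\{-1,1\}$. The mean curvature is $H=\frac{\epsilon}{2}\,\frac{\langle N,X_{ss}\rangle G-2\langle N,X_{st}\rangle F+\langle N,X_{tt}\rangle E}{EG-F^2}$. An immersion $X$ of a nondegenerate surface $M$ with nonzero mean curvature is a homothetic self-similar solution of the inverse mean curvature flow $\partial_tX=-\frac1HN$ if, for some positive function $\phi$ with $\phi(0)=1$, the family $\phi(t)X$ is a solution of the flow; this is expressed equivalently by the equation $C\langle N,X\rangle=-\frac1H$ for some constant $C\in\mathbb{R}\setminus\{0\}$, which is the constant $C$ in the statement. A ruled surface $X(s,t)=\gamma(s)+t\beta(s)$ is cylindrical if $\beta$ is a constant vector field.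
   Formalization: The formulas hold after a translation s→s+s0 of arc length; for C=2 and a curve not defined on all of R, f may have an extra linear term l·s (the printed claim fails there), and the second integral for t(s) is asserted only when l=0. Signs ± are fixed on each interval where f≠0. *)

(* Defs.v *)
From Stdlib Require Import Reals Lra.
From Coquelicot Require Import Coquelicot.

Open Scope R_scope.

Definition L3 : Type := (R * R * R)%type.

Definition crd1 (v : L3) : R := fst (fst v).
Definition crd2 (v : L3) : R := snd (fst v).
Definition crd3 (v : L3) : R := snd v.

Definition ladd (u v : L3) : L3 := (crd1 u + crd1 v, crd2 u + crd2 v, crd3 u + crd3 v).
Definition lscal (a : R) (v : L3) : L3 := (a * crd1 v, a * crd2 v, a * crd3 v).

Definition ldot (u v : L3) : R := crd1 u * crd1 v + crd2 u * crd2 v - crd3 u * crd3 v.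
Definition lnorm (v : L3) : R := sqrt (Rabs (ldot v v)).

Definition det3 (u v w : L3) : R :=
  crd1 u * (crd2 v * crd3 w - crd3 v * crd2 w)
  - crd2 u * (crd1 v * crd3 w - crd3 v * crd1 w)
  + crd3 u * (crd1 v * crd2 w - crd2 v * crd1 w).

(* The sign of the third component comes from the signature; see [lcrossE]. *)
Definition lcross (u v : L3) : L3 :=
  (crd2 u * crd3 v - crd3 u * crd2 v,
   crd3 u * crd1 v - crd1 u * crd3 v,
   crd2 u * crd1 v - crd1 u * crd2 v).

Lemma lcrossE (u v x : L3) : ldot (lcross u v) x = det3 x u v.
Proof. unfold ldot, lcross, det3; simpl; unfold crd1, crd2, crd3; simpl; ring. Qed.

Definition oint (a b : Rbar) (s : R) : Prop := Rbar_lt a s /\ Rbar_lt s b.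

(* On an open interval, having derivatives of every order at every point is
   the same as being of class C^oo. *)
Definition smooth_on (a b : Rbar) (g : R -> R) : Prop :=
  forall (n : nat) (s : R), oint a b s -> ex_derive_n g n s.

Definition pder_s (X : R -> R -> L3) (s t : R) : L3 :=
  (Derive (fun u => crd1 (X u t)) s,
   Derive (fun u => crd2 (X u t)) s,
   Derive (fun u => crd3 (X u t)) s).

Definition pder_t (X : R -> R -> L3) (s t : R) : L3 :=
  (Derive (fun u => crd1 (X s u)) t,
   Derive (fun u => crd2 (X s u)) t,
   Derive (fun u => crd3 (X s u)) t).

Definition coefE (X : R -> R -> L3) (s t : R) : R :=
  ldot (pder_s X s t) (pder_s X s t).
Definition coefF (X : R -> R -> L3) (s t : R) : R :=
  ldot (pder_s X s t) (pder_t X s t).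
Definition coefG (X : R -> R -> L3) (s t : R) : R :=
  ldot (pder_t X s t) (pder_t X s t).

Definition EGF2 (X : R -> R -> L3) (s t : R) : R :=
  coefE X s t * coefG X s t - (coefF X s t) ^ 2.

Definition nondegenerate (D : R -> R -> Prop) (X : R -> R -> L3) : Prop :=
  forall s t, D s t -> EGF2 X s t <> 0.

Definition is_unit_normal (X : R -> R -> L3) (s t : R) (N : L3) : Prop :=
  let n := lcross (pder_s X s t) (pder_t X s t) in
  N = lscal (/ lnorm n) n \/ N = lscal (- / lnorm n) n.

Definition mean_curvature (X : R -> R -> L3) (s t : R) (N : L3) : R :=
  ldot N N / 2 *
  ((ldot N (pder_s (pder_s X) s t) * coefG X s t
    - 2 * ldot N (pder_t (pder_s X) s t) * coefF X s t
    + ldot N (pder_t (pder_t X) s t) * coefE X s t)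
   / EGF2 X s t).

(* The condition does not depend on the choice of the unit normal: replacing N
   by -N changes the sign of both sides of the equation. *)
Definition homothetic_self_similar
    (D : R -> R -> Prop) (X : R -> R -> L3) (C : R) : Prop :=
  C <> 0 /\
  exists N : R -> R -> L3, forall s t, D s t ->
    is_unit_normal X s t (N s t) /\
    mean_curvature X s t (N s t) <> 0 /\
    C * ldot (N s t) (X s t) = - (1 / mean_curvature X s t (N s t)).

Definition ruled (gamma beta : R -> L3) (s t : R) : L3 :=
  ladd (gamma s) (lscal t (beta s)).

Definition is_sign (e : R) : Prop := e = 1 \/ e = -1.

(* For C = 2 the quadratic term disappears, so a linear term l * s cannot be
   removed by a translation of the arc length parameter.  It does occur: for
   s > -1/4 and u = sqrt (4 * s + 1), the curve with
   y + x = exp u * (u - 1) / 2 and y - x = exp (- u) * (u + 1) / 2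
   satisfies the hypotheses with delta = 1 and C = 2, and y^2 - x^2 = s. *)
Definition f_profile (delta C l k s : R) : R :=
  delta * (2 / C - 1) * s ^ 2 + l * s + k.

Definition dt_first (delta : R) (f : R -> R) (s : R) : R :=
  sqrt (4 * delta * f s + (Derive f s) ^ 2) / (2 * Rabs (f s)).

Definition dt_second (delta C k s : R) : R :=
  sqrt (2 * (2 - C) * s ^ 2 + delta * k * C ^ 2)
  / Rabs ((2 - C) * s ^ 2 + delta * k * C).

(* Main.v *)
Require Import Defs.
From Stdlib Require Import Reals Ranalysis5 Lra Classical.
From Coquelicot Require Import Coquelicot.

Open Scope R_scope.

(** Since [w] is a unit vector orthogonal to the plane of the curve, the
    equation [C <N, X> = - 1 / H] of the cylinder is an equation for the plane
    curve [(x, y)] alone: with the two determinants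
    [A = x y' - y x'] and [B = x'' y' - y'' x'], it reads [C A B = 2]
    ([cylinder_self_similar]).

    The quantity to look at is [f = y^2 - x^2].  Differentiating the arc length
    condition makes [(x'', y'')] a multiple of [(y', x')], and then
    [f'' = 2 delta (A B - 1)].  As [A B = 2 / C] is constant, [f] is a quadratic
    polynomial with leading coefficient [delta (2 / C - 1)]
    ([cylinder_profile_quadratic]).  A translation of [s] removes the linear term
    as soon as that coefficient is nonzero.

    The other ingredient is the algebraic identity
    [f'^2 + 4 delta f = 4 A^2] ([arc_length_momentum]).  Because [A] never
    vanishes, [f] cannot vanish identically, and an affine [f] on the whole line
    must be constant.

    Where [f <> 0], the curve has hyperbolic polar coordinates, given in terms of
    the null coordinates [y + x] and [y - x] by
    [r = sign (x + y) sqrt |f|] and [t = ln |(y + x) / (y - x)| / 2].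
    The angle satisfies [t' = - A / f], so
    [|t'| = sqrt (4 delta f + f'^2) / (2 |f|)] by the identity above; the signs of
    [A], [f] and [x + y] are constant on an interval by the intermediate value
    theorem. *)

(** * Open intervals with endpoints in the extended line *)

Lemma oint_open (a b : Rbar) (s : R) : oint a b s -> locally s (oint a b).
Proof.
intros [h1 h2].
apply filter_and.
- exact (open_Rbar_gt a s h1).
- exact (open_Rbar_lt b s h2).
Qed.

Lemma oint_convex (a b : Rbar) (u v s : R) :
  oint a b u -> oint a b v -> u <= s <= v -> oint a b s.
Proof.
intros [h1 h2] [h3 h4] [h5 h6]; split.
- apply (Rbar_lt_le_trans a u s); assumption.
- apply (Rbar_le_lt_trans s v b); assumption.
Qed.

Lemma oint_inhabited (a b : Rbar) : Rbar_lt a b -> exists s, oint a b s.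
Proof.
unfold oint; destruct a as [a| |], b as [b| |]; simpl; intros h;
  try contradiction.
- exists ((a + b) / 2); simpl; lra.
- exists (a + 1); simpl; split; [lra | exact I].
- exists (b - 1); simpl; split; [exact I | lra].
- exists 0; simpl; auto.
Qed.

Lemma is_derive_zero_const (a b : Rbar) (g : R -> R) :
  (forall s, oint a b s -> is_derive g s 0) ->
  forall u v, oint a b u -> oint a b v -> g u = g v.
Proof.
intros hg.
assert (H : forall u v, oint a b u -> oint a b v -> u < v -> g u = g v).
{ intros u v hu hv huv.
  apply (eq_is_derive g u v); [|exact huv].
  intros t ht; apply hg; exact (oint_convex a b u v t hu hv ht). }
intros u v hu hv.
destruct (Rtotal_order u v) as [h|[h|h]].
- exact (H u v hu hv h).
- now rewrite h.
- symmetry; exact (H v u hv hu h).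
Qed.

Lemma is_derive2_const_quadratic (a b : Rbar) (g g' : R -> R) (c : R) :
  Rbar_lt a b ->
  (forall s, oint a b s -> is_derive g s (g' s)) ->
  (forall s, oint a b s -> is_derive g' s (2 * c)) ->
  exists l k, forall s, oint a b s ->
    g s = c * s ^ 2 + l * s + k /\ g' s = 2 * c * s + l.
Proof.
intros hab hg hg'.
destruct (oint_inhabited a b hab) as [u hu].
set (l := g' u - 2 * c * u).
assert (H1 : forall s, oint a b s -> g' s = 2 * c * s + l).
{ intros s hs.
  assert (E : g' s - 2 * c * s = g' u - 2 * c * u).
  { apply (is_derive_zero_const a b (fun s => g' s - 2 * c * s)); auto.
    intros z hz.
    evar_last; [apply (is_derive_minus g' (fun s => 2 * c * s))|].
    - exact (hg' z hz).
    - auto_derive; [exact I | reflexivity].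
    - unfold minus, plus, opp; simpl; ring. }
  unfold l; lra. }
exists l, (g u - (c * u ^ 2 + l * u)).
intros s hs; split; [|exact (H1 s hs)].
assert (E : g s - (c * s ^ 2 + l * s) = g u - (c * u ^ 2 + l * u)).
{ apply (is_derive_zero_const a b (fun s => g s - (c * s ^ 2 + l * s))); auto.
  intros z hz.
  evar_last; [apply (is_derive_minus g (fun s => c * s ^ 2 + l * s))|].
  - exact (hg z hz).
  - auto_derive; [exact I | reflexivity].
  - rewrite (H1 z hz); unfold minus, plus, opp; simpl; ring. }
lra.
Qed.

Lemma nonvanishing_constant_sign (a b : Rbar) (g : R -> R) :
  (forall s, oint a b s -> continuous g s) ->
  (forall s, oint a b s -> g s <> 0) ->
  exists e, is_sign e /\ forall s, oint a b s -> 0 < e * g s.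
Proof.
intros hc hn.
assert (noroot : forall (h : R -> R) u v,
  (forall s, oint a b s -> continuous h s) ->
  (forall s, oint a b s -> h s <> 0) ->
  oint a b u -> oint a b v -> u < v -> h u < 0 -> 0 < h v -> False).
{ intros h u v ch nh hu hv huv hgu hgv.
  destruct (IVT_interv h u v) as [z [hz ez]]; auto.
  - intros z hz; apply continuity_pt_filterlim.
    apply ch; exact (oint_convex a b u v z hu hv hz).
  - exact (nh z (oint_convex a b u v z hu hv hz) ez). }
destruct (classic (exists u, oint a b u /\ 0 < g u)) as [[u [hu hgu]]|hno].
- exists 1; split; [now left|].
  intros s hs; rewrite Rmult_1_l.
  destruct (Rtotal_order (g s) 0) as [h|[h|h]]; [exfalso| |exact h].
  + destruct (Rtotal_order s u) as [k|[k|k]].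
    * exact (noroot g s u hc hn hs hu k h hgu).
    * subst; lra.
    * apply (noroot (fun z => - g z) u s); auto; try lra.
      -- intros z hz; apply (continuous_opp g); auto.
      -- intros z hz E; apply (hn z hz); lra.
  + exfalso; exact (hn s hs h).
- exists (-1); split; [now right|].
  intros s hs.
  destruct (Rtotal_order (g s) 0) as [h|[h|h]]; [lra| |].
  + exfalso; exact (hn s hs h).
  + exfalso; apply hno; now exists s.
Qed.

(** * The self-similarity equation of a cylinder *)

Definition cylinder (x y : R -> R) : R -> R -> L3 :=
  ruled (fun s => (0, x s, y s)) (fun _ => (1, 0, 0)).

Definition momentum (x y : R -> R) (s : R) : R :=
  x s * Derive y s - y s * Derive x s.

Lemma cylinder_pder_s (x y : R -> R) (s t : R) :
  pder_s (cylinder x y) s t = (0, Derive x s, Derive y s).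
Proof.
unfold pder_s, cylinder, ruled, ladd, lscal, crd1, crd2, crd3; simpl.
rewrite Derive_const.
rewrite (Derive_ext (fun u => x u + t * 0) x) by (intros; ring).
rewrite (Derive_ext (fun u => y u + t * 0) y) by (intros; ring).
reflexivity.
Qed.

Lemma cylinder_pder_t (x y : R -> R) (s t : R) :
  pder_t (cylinder x y) s t = (1, 0, 0).
Proof.
unfold pder_t, cylinder, ruled, ladd, lscal, crd1, crd2, crd3; simpl.
rewrite (Derive_ext (fun u => 0 + u * 1) (fun u => u)) by (intros; ring).
rewrite (Derive_ext (fun u => x s + u * 0) (fun u => x s)) by (intros; ring).
rewrite (Derive_ext (fun u => y s + u * 0) (fun u => y s)) by (intros; ring).
now rewrite Derive_id, !Derive_const.
Qed.

Lemma cylinder_pder_ss (x y : R -> R) (s t : R) :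
  pder_s (pder_s (cylinder x y)) s t
  = (0, Derive (Derive x) s, Derive (Derive y) s).
Proof.
unfold pder_s at 1.
rewrite (Derive_ext _ (fun _ => 0))
  by (intros; now rewrite cylinder_pder_s).
rewrite (Derive_ext (fun u => crd2 _) (Derive x))
  by (intros; now rewrite cylinder_pder_s).
rewrite (Derive_ext (fun u => crd3 _) (Derive y))
  by (intros; now rewrite cylinder_pder_s).
now rewrite Derive_const.
Qed.

Lemma cylinder_pder_tt (x y : R -> R) (s t : R) :
  pder_t (pder_t (cylinder x y)) s t = (0, 0, 0).
Proof.
unfold pder_t at 1.
rewrite (Derive_ext _ (fun _ => 1))
  by (intros; now rewrite cylinder_pder_t).
rewrite (Derive_ext (fun u => crd2 _) (fun _ => 0))
  by (intros; now rewrite cylinder_pder_t).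
rewrite (Derive_ext (fun u => crd3 _) (fun _ => 0))
  by (intros; now rewrite cylinder_pder_t).
now rewrite !Derive_const.
Qed.

(** The normal is [N = ± (0, y', x')], so that [<N, X> = ± A] and
    [H = ∓ B / 2]; the sign disappears from the product. *)
Lemma cylinder_self_similar (D : R -> R -> Prop) (x y : R -> R)
    (delta C s t : R) :
  is_sign delta ->
  (Derive x s) ^ 2 - (Derive y s) ^ 2 = delta ->
  homothetic_self_similar D (cylinder x y) C ->
  D s t ->
  C * momentum x y s
    * (Derive (Derive x) s * Derive y s - Derive (Derive y) s * Derive x s)
  = 2.
Proof.
intros hd harc [hC [N hN]] hst.
destruct (hN s t hst) as [hu [hH heq]]; clear hN.
assert (hN : exists e, is_sign e /\ N s t = (0, e * Derive y s, e * Derive x s)).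
{ unfold is_unit_normal in hu.
  rewrite cylinder_pder_s, cylinder_pder_t in hu.
  assert (hn : lnorm (lcross (0, Derive x s, Derive y s) (1, 0, 0)) = 1).
  { unfold lnorm, ldot, lcross, crd1, crd2, crd3; simpl.
    match goal with |- sqrt (Rabs ?z) = 1 => replace z with (- delta)
      by (rewrite <- harc; ring) end.
    replace (Rabs (- delta)) with 1; [apply sqrt_1|].
    rewrite Rabs_Ropp.
    destruct hd as [-> | ->]; [now rewrite Rabs_R1 | rewrite Rabs_left; lra]. }
  rewrite hn in hu.
  destruct hu as [-> | ->]; [exists 1; split; [now left|] | exists (-1); split; [now right|]];
    unfold lscal, lcross, crd1, crd2, crd3; simpl; f_equal; try f_equal; field. }
destruct hN as [e [he hN]].
set (B := Derive (Derive x) s * Derive y s - Derive (Derive y) s * Derive x s).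
assert (hmc : mean_curvature (cylinder x y) s t (N s t) = - (e * B) / 2).
{ unfold mean_curvature, EGF2, coefE, coefF, coefG.
  assert (hst' : pder_t (pder_s (cylinder x y)) s t = (0, 0, 0)).
  { unfold pder_t.
    rewrite (Derive_ext _ (fun _ => 0))
      by (intros; now rewrite cylinder_pder_s).
    rewrite (Derive_ext (fun u => crd2 _) (fun _ => Derive x s))
      by (intros; now rewrite cylinder_pder_s).
    rewrite (Derive_ext (fun u => crd3 _) (fun _ => Derive y s))
      by (intros; now rewrite cylinder_pder_s).
    now rewrite !Derive_const. }
  rewrite cylinder_pder_ss, cylinder_pder_tt, hst', cylinder_pder_s,
    cylinder_pder_t, hN.
  unfold ldot, crd1, crd2, crd3; simpl; unfold B.
  assert (he2 : e * e = 1) by (destruct he as [-> | ->]; ring).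
  assert (hd0 : delta <> 0) by (destruct hd as [-> | ->]; lra).
  set (x' := Derive x s) in *; set (y' := Derive y s) in *.
  match goal with |- ?n / 2 * (_ / ?d) = _ =>
    replace n with (- delta * (e * e)) by (rewrite <- harc; ring);
    replace d with delta by (rewrite <- harc; ring) end.
  rewrite he2; field; exact hd0. }
rewrite hmc in hH, heq.
rewrite hN in heq.
unfold cylinder, ruled, ladd, lscal, ldot, crd1, crd2, crd3 in heq;
  simpl in heq.
assert (he2 : e * e = 1) by (destruct he as [-> | ->]; ring).
assert (hB : B <> 0) by (intros E; apply hH; rewrite E; field).
assert (he0 : e <> 0) by (destruct he as [-> | ->]; lra).
assert (E : C * (e * momentum x y s) = 2 / (e * B)).
{ unfold momentum. transitivity (- (1 / (- (e * B) / 2))).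
  - rewrite <- heq; ring.
  - field; auto. }
replace (C * momentum x y s * B) with (C * (e * momentum x y s) * (e * B))
  by (transitivity (C * momentum x y s * B * (e * e)); [ring | rewrite he2; ring]).
rewrite E; field; auto.
Qed.

(** * The squared distance of the curve to the origin *)

(** The Lorentzian Lagrange identity [<g, g'>^2 - det (g, g')^2 = <g, g> <g', g'>]
    of the plane, for [<g, g> = - f] and [<g', g'> = delta]. *)
Lemma arc_length_momentum (x y : R -> R) (delta s : R) :
  (Derive x s) ^ 2 - (Derive y s) ^ 2 = delta ->
  4 * delta * (y s ^ 2 - x s ^ 2)
    + (2 * (y s * Derive y s - x s * Derive x s)) ^ 2
  = (2 * momentum x y s) ^ 2.
Proof. intros <-; unfold momentum; ring. Qed.

(** The arc length condition gives [x' x'' = y' y''], whence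
    [y y'' - x x'' = delta A B] and [f'' = 2 delta (A B - 1)]. *)
Lemma cylinder_profile_quadratic (a b : Rbar) (x y : R -> R) (delta C : R) :
  Rbar_lt a b -> smooth_on a b x -> smooth_on a b y ->
  is_sign delta -> C <> 0 ->
  (forall s, oint a b s -> (Derive x s) ^ 2 - (Derive y s) ^ 2 = delta) ->
  (forall s, oint a b s ->
     C * momentum x y s
       * (Derive (Derive x) s * Derive y s - Derive (Derive y) s * Derive x s)
     = 2) ->
  exists l k, forall s, oint a b s ->
    y s ^ 2 - x s ^ 2 = delta * (2 / C - 1) * s ^ 2 + l * s + k /\
    2 * (y s * Derive y s - x s * Derive x s)
    = 2 * (delta * (2 / C - 1)) * s + l.
Proof.
intros hab hx hy hd hC harc heq.
apply (is_derive2_const_quadratic a b (fun s => y s ^ 2 - x s ^ 2)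
  (fun s => 2 * (y s * Derive y s - x s * Derive x s))); auto.
- intros s hs.
  pose proof (hx 1%nat s hs) as dx; pose proof (hy 1%nat s hs) as dy.
  simpl in dx, dy.
  auto_derive; [tauto|].
  change (Derive (fun z => x z) s) with (Derive x s).
  change (Derive (fun z => y z) s) with (Derive y s).
  ring.
- intros s hs.
  pose proof (hx 1%nat s hs) as dx; pose proof (hy 1%nat s hs) as dy.
  pose proof (hx 2%nat s hs) as ddx; pose proof (hy 2%nat s hs) as ddy.
  change (ex_derive x s) in dx; change (ex_derive y s) in dy.
  change (ex_derive (Derive x) s) in ddx; change (ex_derive (Derive y) s) in ddy.
  assert (horth : Derive x s * Derive (Derive x) s = Derive y s * Derive (Derive y) s).
  { assert (E : is_derive (fun z => (Derive x z) ^ 2 - (Derive y z) ^ 2) s 0).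
    { apply (is_derive_ext_loc (fun _ => delta)).
      - generalize (oint_open a b s hs); apply filter_imp.
        intros z hz; symmetry; exact (harc z hz).
      - exact (is_derive_const delta s). }
    assert (E' : is_derive (fun z => (Derive x z) ^ 2 - (Derive y z) ^ 2) s
      (2 * (Derive x s * Derive (Derive x) s - Derive y s * Derive (Derive y) s))).
    { auto_derive; [tauto|].
      change (Derive (fun z => Derive x z) s) with (Derive (Derive x) s).
      change (Derive (fun z => Derive y z) s) with (Derive (Derive y) s).
      ring. }
    apply is_derive_unique in E; apply is_derive_unique in E'.
    rewrite E in E'; lra. }
  evar_last.
  { auto_derive; [tauto | reflexivity]. }
  change (Derive (fun z => Derive x z) s) with (Derive (Derive x) s).
  change (Derive (fun z => Derive y z) s) with (Derive (Derive y) s).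
  change (Derive (fun w => x w) s) with (Derive x s).
  change (Derive (fun w => y w) s) with (Derive y s).
  pose proof (harc s hs) as ha; pose proof (heq s hs) as hs2.
  unfold momentum in hs2.
  set (x' := Derive x s) in *; set (y' := Derive y s) in *.
  set (x2 := Derive (Derive x) s) in *; set (y2 := Derive (Derive y) s) in *.
  assert (hAB : (x s * y' - y s * x') * (x2 * y' - y2 * x') = 2 / C).
  { apply (Rmult_eq_reg_l C); [|exact hC].
    transitivity 2; [rewrite <- hs2; ring | field; exact hC]. }
  assert (K : y s * y2 - x s * x2
    = delta * ((x s * y' - y s * x') * (x2 * y' - y2 * x'))).
  { assert (hd2 : delta * delta = 1) by (destruct hd as [-> | ->]; ring).
    (* The acceleration is [- delta B] times [(y', x')]. *)
    assert (ky : y2 = - delta * x' * (x2 * y' - y2 * x')).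
    { transitivity (delta * delta * y2); [rewrite hd2; ring|].
      rewrite <- ha at 2.
      transitivity (delta * (x' * x' * y2 - y' * (y' * y2))); [ring|].
      rewrite <- horth; ring. }
    assert (kx : x2 = - delta * y' * (x2 * y' - y2 * x')).
    { transitivity (delta * delta * x2); [rewrite hd2; ring|].
      rewrite <- ha at 2.
      transitivity (delta * (x' * (x' * x2) - y' * y' * x2)); [ring|].
      rewrite horth; ring. }
    rewrite ky at 1; rewrite kx at 2; ring. }
  rewrite hAB in K.
  transitivity (2 * (y' ^ 2 - x' ^ 2) + 2 * (y s * y2 - x s * x2)); [ring|].
  rewrite K; replace (y' ^ 2 - x' ^ 2) with (- delta) by (rewrite <- ha; ring).
  ring.
Qed.

(** * Hyperbolic polar coordinates *)

(** The sign of the null coordinate [u + v] tells apart the two branches of a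
    hyperbola, whichever of its two axes it crosses. *)
Definition hyp_radius (u v : R) : R := sign (u + v) * sqrt (Rabs (v ^ 2 - u ^ 2)).

Definition hyp_angle (u v : R) : R := (ln (Rabs (v + u)) - ln (Rabs (v - u))) / 2.

(** In null coordinates the polar form is multiplicative: [|v + u|] and [|v - u|]
    are [|r| e^t] and [|r| e^(-t)]; only the signs are left to compare. *)
Lemma hyp_polar_exp (u v : R) : v ^ 2 - u ^ 2 <> 0 ->
  hyp_radius u v * exp (hyp_angle u v) = u + v /\
  hyp_radius u v * exp (- hyp_angle u v)
  = sign (v ^ 2 - u ^ 2) * (v - u).
Proof.
intros h.
assert (hf : v ^ 2 - u ^ 2 = (v + u) * (v - u)) by ring.
assert (hp : v + u <> 0) by (intros E; apply h; rewrite hf, E; ring).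
assert (hm : v - u <> 0) by (intros E; apply h; rewrite hf, E; ring).
pose proof (Rabs_pos_lt _ hp) as ap; pose proof (Rabs_pos_lt _ hm) as am.
assert (hs : sqrt (Rabs (v ^ 2 - u ^ 2))
  = exp ((ln (Rabs (v + u)) + ln (Rabs (v - u))) / 2)).
{ apply sqrt_lem_1.
  - apply Rabs_pos.
  - apply Rlt_le, exp_pos.
  - rewrite <- exp_plus.
    replace (v ^ 2 - u ^ 2) with ((v + u) * (v - u)) by ring.
    rewrite Rabs_mult.
    rewrite <- (exp_ln _ ap) at 3.
    rewrite <- (exp_ln _ am) at 3.
    rewrite <- exp_plus; f_equal; field. }
assert (habs : forall z, sign z * Rabs z = z).
{ intros z; destruct (Rtotal_order z 0) as [k|[->|k]].
  - rewrite sign_eq_m1, Rabs_left by exact k; ring.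
  - rewrite Rabs_R0; ring.
  - rewrite sign_eq_1, Rabs_right by lra; ring. }
assert (hss : sign (v + u) * sign (v + u) = 1).
{ destruct (Rdichotomy _ _ hp) as [k|k].
  - rewrite sign_eq_m1 by exact k; ring.
  - rewrite sign_eq_1 by exact k; ring. }
unfold hyp_radius, hyp_angle; rewrite hs.
rewrite (Rplus_comm u v).
rewrite !Rmult_assoc, <- !exp_plus.
split.
- match goal with |- _ * exp ?z = _ =>
    replace z with (ln (Rabs (v + u))) by field end.
  rewrite exp_ln by exact ap; apply habs.
- match goal with |- _ * exp ?z = _ =>
    replace z with (ln (Rabs (v - u))) by field end.
  rewrite exp_ln by exact am.
  replace (v ^ 2 - u ^ 2) with ((v + u) * (v - u)) by ring.
  rewrite sign_mult.
  rewrite <- (habs (v - u)) at 3.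
  assert (hmm : sign (v - u) * sign (v - u) = 1).
  { destruct (Rdichotomy _ _ hm) as [k|k].
    - rewrite sign_eq_m1 by exact k; ring.
    - rewrite sign_eq_1 by exact k; ring. }
  transitivity (sign (v + u) * (sign (v - u) * sign (v - u)) * Rabs (v - u)); [|ring].
  rewrite hmm; ring.
Qed.

Lemma hyp_polar_timelike (u v : R) : 0 < v ^ 2 - u ^ 2 ->
  u = hyp_radius u v * sinh (hyp_angle u v) /\
  v = hyp_radius u v * cosh (hyp_angle u v).
Proof.
intros h; destruct (hyp_polar_exp u v) as [e1 e2]; [lra|].
rewrite sign_eq_1 in e2 by exact h.
unfold sinh, cosh; split; lra.
Qed.

Lemma hyp_polar_spacelike (u v : R) : v ^ 2 - u ^ 2 < 0 ->
  u = hyp_radius u v * cosh (hyp_angle u v) /\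
  v = hyp_radius u v * sinh (hyp_angle u v).
Proof.
intros h; destruct (hyp_polar_exp u v) as [e1 e2]; [lra|].
rewrite sign_eq_m1 in e2 by exact h.
unfold sinh, cosh; split; lra.
Qed.

Lemma is_derive_ln_Rabs (g : R -> R) (s : R) :
  ex_derive g s -> g s <> 0 ->
  is_derive (fun z => ln (Rabs (g z))) s (Derive g s / g s).
Proof.
intros dg h; auto_derive.
- repeat split; auto; apply Rabs_pos_lt; exact h.
- change (Derive (fun z => g z) s) with (Derive g s).
  destruct (Rdichotomy _ _ h) as [k|k].
  + rewrite sign_eq_m1, Rabs_left by exact k; field; exact h.
  + rewrite sign_eq_1, Rabs_right by lra; field; exact h.
Qed.

Lemma is_derive_hyp_angle (x y : R -> R) (s : R) :
  ex_derive x s -> ex_derive y s -> y s ^ 2 - x s ^ 2 <> 0 ->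
  is_derive (fun z => hyp_angle (x z) (y z)) s
    (- momentum x y s / (y s ^ 2 - x s ^ 2)).
Proof.
intros dx dy h.
assert (hf : y s ^ 2 - x s ^ 2 = (y s + x s) * (y s - x s)) by ring.
assert (hp : y s + x s <> 0) by (intros E; apply h; rewrite hf, E; ring).
assert (hm : y s - x s <> 0) by (intros E; apply h; rewrite hf, E; ring).
pose proof (is_derive_ln_Rabs (fun z => y z + x z) s
  (ex_derive_plus y x s dy dx) hp) as Dp.
pose proof (is_derive_ln_Rabs (fun z => y z - x z) s
  (ex_derive_minus y x s dy dx) hm) as Dm.
rewrite (Derive_plus y x) in Dp by auto.
rewrite (Derive_minus y x) in Dm by auto.
pose proof (is_derive_scal _ s (/ 2) _ (is_derive_minus _ _ s _ _ Dp Dm)) as D.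
evar_last.
- refine (is_derive_ext _ _ s _ _ D).
  intros z; unfold hyp_angle, minus, plus, opp; simpl; field.
- rewrite hf; unfold minus, plus, opp, momentum; simpl; field; auto.
Qed.

(** * The speed of the hyperbolic angle *)

Lemma Derive_f_profile (delta C l k s : R) :
  Derive (f_profile delta C l k) s = 2 * (delta * (2 / C - 1)) * s + l.
Proof.
apply is_derive_unique; unfold f_profile; auto_derive; [exact I | ring].
Qed.

Lemma dt_first_momentum (delta A s : R) (f : R -> R) :
  4 * delta * f s + (Derive f s) ^ 2 = (2 * A) ^ 2 -> f s <> 0 ->
  dt_first delta f s = Rabs A / Rabs (f s).
Proof.
intros h hf; unfold dt_first; rewrite h.
replace ((2 * A) ^ 2) with (Rsqr (2 * A)) by (unfold Rsqr; ring).
rewrite sqrt_Rsqr_abs, Rabs_mult, (Rabs_right 2) by lra.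
field; apply Rabs_no_R0; exact hf.
Qed.

(** Both radicands and denominators are proportional:
    [4 delta f + f'^2 = (2 / C)^2 (2 (2 - C) s^2 + delta k C^2)] and
    [f = (delta / C) ((2 - C) s^2 + delta k C)]. *)
Lemma dt_firstE (delta C k s : R) :
  is_sign delta -> C <> 0 -> f_profile delta C 0 k s <> 0 ->
  dt_first delta (f_profile delta C 0 k) s = dt_second delta C k s.
Proof.
intros hd hC hf.
assert (hd2 : delta * delta = 1) by (destruct hd as [-> | ->]; ring).
assert (ef : f_profile delta C 0 k s
  = delta * / C * ((2 - C) * s ^ 2 + delta * k * C)).
{ transitivity (delta * (2 / C - 1) * s ^ 2 + delta * delta * k).
  - unfold f_profile; rewrite hd2; ring.
  - field; exact hC. }
assert (hq : (2 - C) * s ^ 2 + delta * k * C <> 0)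
  by (intros E; apply hf; rewrite ef, E; ring).
assert (had : Rabs delta = 1)
  by (destruct hd as [-> | ->]; [apply Rabs_R1 | rewrite Rabs_left; lra]).
unfold dt_first, dt_second.
replace (4 * delta * f_profile delta C 0 k s
  + Derive (f_profile delta C 0 k) s ^ 2)
  with (Rsqr (2 * / C) * (2 * (2 - C) * s ^ 2 + delta * k * C ^ 2)).
2:{ rewrite Derive_f_profile; unfold f_profile, Rsqr.
  transitivity (4 * (delta * delta) * (2 / C - 1) * s ^ 2 + 4 * delta * k
    + 4 * (delta * delta) * (2 / C - 1) ^ 2 * s ^ 2);
    [rewrite hd2; field; exact hC | ring]. }
rewrite sqrt_mult_alt by apply Rle_0_sqr.
rewrite sqrt_Rsqr_abs, ef, !Rabs_mult, had, (Rabs_right 2) by lra.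
rewrite Rabs_inv.
field; split; apply Rabs_no_R0; auto.
Qed.

(** * The classification *)

(** For [C <> 2] the translation is to the vertex of the parabola.  For [C = 2] and a curve
    defined on the whole line, [4 delta f + f'^2] is affine with slope
    [4 delta l] and never vanishes, so [l = 0]. *)
Lemma normalize_profile (a b : Rbar) (delta C l k : R) :
  is_sign delta -> C <> 0 ->
  (forall s, oint a b s ->
     4 * delta * f_profile delta C l k s
       + (Derive (f_profile delta C l k) s) ^ 2 <> 0) ->
  exists s0 l' k',
    (C <> 2 \/ (a = m_infty /\ b = p_infty) -> l' = 0) /\
    forall s, f_profile delta C l' k' s = f_profile delta C l k (s + s0) /\
      Derive (f_profile delta C l' k') s
      = Derive (f_profile delta C l k) (s + s0).
Proof.
intros hd hC hne.
assert (hd0 : delta <> 0) by (destruct hd as [-> | ->]; lra).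
destruct (Req_dec C 2) as [h2|h2].
- exists 0, l, k; split.
  + intros [h|[-> ->]]; [contradiction|].
    destruct (Req_dec l 0) as [h|h]; [exact h|exfalso].
    apply (hne (- (4 * delta * k + l ^ 2) / (4 * delta * l))).
    * split; exact I.
    * rewrite Derive_f_profile; unfold f_profile; rewrite h2; field; auto.
  + intros s; now rewrite Rplus_0_r.
- set (c := delta * (2 / C - 1)).
  assert (hc : c <> 0).
  { intros E; unfold c in E; apply Rmult_integral in E.
    destruct E as [E|E]; [auto|].
    apply h2; replace C with (C * (2 / C - (2 / C - 1))) by ring.
    rewrite E; field; exact hC. }
  exists (- l / (2 * c)), 0, (k - l ^ 2 / (4 * c)); split; [auto|].
  intros s; rewrite !Derive_f_profile; unfold f_profile; fold c.
  split; field; exact hc.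
Qed.

(** The signs [e1] and [e2] are those of [- A / f] and of [x + y].  Both are
    continuous and do not vanish where [f <> 0], because
    [f = (y + x) (y - x)]. *)
Lemma cylinder_hyperbolic_polar (a b : Rbar) (x y : R -> R) (delta C s0 l k : R) :
  smooth_on a b x -> smooth_on a b y -> is_sign delta -> C <> 0 ->
  (forall s, oint a b s -> momentum x y s <> 0) ->
  (forall s, oint a b (s + s0) ->
     f_profile delta C l k s = y (s + s0) ^ 2 - x (s + s0) ^ 2 /\
     4 * delta * f_profile delta C l k s
       + (Derive (f_profile delta C l k) s) ^ 2
     = (2 * momentum x y (s + s0)) ^ 2) ->
  forall c d : Rbar,
  (forall s, oint c d s -> oint a b (s + s0) /\ f_profile delta C l k s <> 0) ->
  exists e1 e2 : R, is_sign e1 /\ is_sign e2 /\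
    forall s, oint c d s ->
      is_derive (fun s => hyp_angle (x (s + s0)) (y (s + s0))) s
        (e1 * dt_first delta (f_profile delta C l k) s) /\
      (l = 0 ->
       is_derive (fun s => hyp_angle (x (s + s0)) (y (s + s0))) s
         (e1 * dt_second delta C k s)) /\
      hyp_radius (x (s + s0)) (y (s + s0))
      = e2 * sqrt (Rabs (f_profile delta C l k s)).
Proof.
intros hx hy hd hC hA hf c d hcd.
set (f := f_profile delta C l k) in *.
assert (dx : forall s, oint a b s -> ex_derive x s)
  by (intros s hs; exact (hx 1%nat s hs)).
assert (dy : forall s, oint a b s -> ex_derive y s)
  by (intros s hs; exact (hy 1%nat s hs)).
assert (cx : forall s, oint a b s -> ex_derive (Derive x) s)
  by (intros s hs; exact (hx 2%nat s hs)).
assert (cy : forall s, oint a b s -> ex_derive (Derive y) s)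
  by (intros s hs; exact (hy 2%nat s hs)).
assert (shift : forall (g : R -> R) s, ex_derive g (s + s0) -> ex_derive (fun z => g (z + s0)) s).
{ intros g s dg; auto_derive; auto. }
destruct (nonvanishing_constant_sign c d
  (fun s => - momentum x y (s + s0) / f s)) as [e1 [he1 hs1]].
{ intros s hs; destruct (hcd s hs) as [hab hf0].
  apply (ex_derive_continuous (fun s => - momentum x y (s + s0) / f s)).
  apply ex_derive_div; [|unfold f, f_profile; auto_derive; exact I | exact hf0].
  apply (shift (fun z => - momentum x y z)).
  unfold momentum; auto_derive; auto 10. }
{ intros s hs; destruct (hcd s hs) as [hab hf0].
  intros E; apply (hA _ hab).
  apply (Rmult_eq_reg_r (- / f s));
    [|apply Ropp_neq_0_compat, Rinv_neq_0_compat; exact hf0].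
  rewrite Rmult_0_l, <- E; field; exact hf0. }
assert (hxy : forall s, oint c d s -> x (s + s0) + y (s + s0) <> 0).
{ intros s hs E; destruct (hcd s hs) as [hab hf0]; apply hf0.
  rewrite (proj1 (hf s hab)).
  transitivity ((x (s + s0) + y (s + s0)) * (y (s + s0) - x (s + s0))); [ring|].
  rewrite E; ring. }
destruct (nonvanishing_constant_sign c d
  (fun s => x (s + s0) + y (s + s0))) as [e2 [he2 hs2]].
{ intros s hs; destruct (hcd s hs) as [hab _].
  apply (ex_derive_continuous (fun s => x (s + s0) + y (s + s0))).
  apply (ex_derive_plus (fun s => x (s + s0)) (fun s => y (s + s0)));
    apply shift; auto. }
{ exact hxy. }
exists e1, e2; split; [exact he1|]; split; [exact he2|].
intros s hs; destruct (hcd s hs) as [hab hf0].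
destruct (hf s hab) as [hfs hmom].
assert (D : is_derive (fun s => hyp_angle (x (s + s0)) (y (s + s0))) s
  (e1 * dt_first delta f s)).
{ pose proof (is_derive_hyp_angle x y (s + s0) (dx _ hab) (dy _ hab)) as D.
  rewrite <- hfs in D; specialize (D hf0).
  evar_last.
  - apply (is_derive_comp (fun z => hyp_angle (x z) (y z)) (fun s => s + s0) s);
      [exact D | auto_derive; [exact I | reflexivity]].
  - rewrite (dt_first_momentum delta _ s f hmom hf0).
    pose proof (hs1 s hs) as hpos; cbv beta in hpos.
    unfold scal; simpl; unfold mult; simpl.
    rewrite <- Rabs_div by exact hf0.
    rewrite <- Rabs_Ropp.
    replace (- (momentum x y (s + s0) / f s))
      with (- momentum x y (s + s0) / f s) by (field; exact hf0).
    set (m := - momentum x y (s + s0) / f s) in *.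
    destruct he1 as [-> | ->].
    + rewrite Rabs_right by lra; ring.
    + rewrite Rabs_left by lra; ring. }
split; [exact D|]; split.
- intros hl; rewrite <- (dt_firstE delta C k s hd hC); unfold f in *; rewrite hl in *; auto.
- unfold hyp_radius; rewrite <- hfs; f_equal.
  pose proof (hs2 s hs) as hpos; cbv beta in hpos.
  destruct he2 as [-> | ->].
  + apply sign_eq_1; lra.
  + apply sign_eq_m1; lra.
Qed.

Theorem theorem4p1
  (a b p q : Rbar) (hab : Rbar_lt a b) (hpq : Rbar_lt p q)
  (x y : R -> R) (delta C : R)
  (hx : smooth_on a b x) (hy : smooth_on a b y)
  (hdelta : is_sign delta)
  (harc : forall s, oint a b s -> (Derive x s) ^ 2 - (Derive y s) ^ 2 = delta)
  (hnd : nondegenerate (fun s t => oint a b s /\ oint p q t)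
           (ruled (fun s => (0, x s, y s)) (fun _ => (1, 0, 0))))
  (hss : homothetic_self_similar (fun s t => oint a b s /\ oint p q t)
           (ruled (fun s => (0, x s, y s)) (fun _ => (1, 0, 0))) C) :
  exists s0 l k : R,
    (C <> 2 \/ (a = m_infty /\ b = p_infty) -> l = 0) /\
    let f := f_profile delta C l k in
    (exists s, oint a b (s + s0) /\ f s <> 0) /\
    exists t r : R -> R,
      (forall s, oint a b (s + s0) ->
         (0 < f s ->
            (0, x (s + s0), y (s + s0))
            = (0, r s * sinh (t s), r s * cosh (t s)) :> L3) /\
         (f s < 0 ->
            (0, x (s + s0), y (s + s0))
            = (0, r s * cosh (t s), r s * sinh (t s)) :> L3)) /\
      (forall c d : Rbar,
         (forall s, oint c d s -> oint a b (s + s0) /\ f s <> 0) ->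
         exists e1 e2 : R, is_sign e1 /\ is_sign e2 /\
           forall s, oint c d s ->
             is_derive t s (e1 * dt_first delta f s) /\
             (l = 0 -> is_derive t s (e1 * dt_second delta C k s)) /\
             r s = e2 * sqrt (Rabs (f s))).
Proof.
assert (hC : C <> 0) by exact (proj1 hss).
destruct (oint_inhabited p q hpq) as [t0 ht0].
assert (heq : forall s, oint a b s ->
  C * momentum x y s
    * (Derive (Derive x) s * Derive y s - Derive (Derive y) s * Derive x s) = 2).
{ intros s hs.
  exact (cylinder_self_similar _ x y delta C s t0 hdelta (harc s hs) hss
    (conj hs ht0)). }
assert (hA : forall s, oint a b s -> momentum x y s <> 0).
{ intros s hs E; pose proof (heq s hs) as h; rewrite E in h; lra. }
destruct (cylinder_profile_quadratic a b x y delta C hab hx hy hdelta hC harc heq)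
  as [l1 [k1 hquad]].
assert (hprof : forall s, oint a b s ->
  f_profile delta C l1 k1 s = y s ^ 2 - x s ^ 2 /\
  4 * delta * f_profile delta C l1 k1 s
    + (Derive (f_profile delta C l1 k1) s) ^ 2 = (2 * momentum x y s) ^ 2).
{ intros s hs; destruct (hquad s hs) as [h1 h2].
  rewrite Derive_f_profile, <- h2.
  change (f_profile delta C l1 k1 s)
    with (delta * (2 / C - 1) * s ^ 2 + l1 * s + k1).
  rewrite <- h1; split; [reflexivity|].
  exact (arc_length_momentum x y delta s (harc s hs)). }
assert (hne : forall s, oint a b s ->
  4 * delta * f_profile delta C l1 k1 s
    + (Derive (f_profile delta C l1 k1) s) ^ 2 <> 0).
{ intros s hs; rewrite (proj2 (hprof s hs)).
  apply pow_nonzero; pose proof (hA s hs); lra. }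
destruct (normalize_profile a b delta C l1 k1 hdelta hC hne)
  as [s0 [l [k [hl hshift]]]].
exists s0, l, k; split; [exact hl|]; intros f.
assert (hf : forall s, oint a b (s + s0) ->
  f s = y (s + s0) ^ 2 - x (s + s0) ^ 2 /\
  4 * delta * f s + (Derive f s) ^ 2 = (2 * momentum x y (s + s0)) ^ 2).
{ intros s hs; unfold f; destruct (hshift s) as [-> ->]; exact (hprof _ hs). }
split.
- apply NNPP; intros hno.
  destruct (oint_inhabited a b hab) as [u hu].
  (* If [f] vanished identically, then so would [f'] and hence [A]. *)
  assert (hz : forall s, oint a b s -> y s ^ 2 - x s ^ 2 = 0).
  { intros s hs; apply NNPP; intros h; apply hno; exists (s - s0).
    assert (E : s - s0 + s0 = s) by ring.
    pose proof (hf (s - s0)) as h'; rewrite E in *; split; [exact hs|].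
    rewrite (proj1 (h' hs)); exact h. }
  apply (hne u hu).
  rewrite (proj1 (hprof u hu)), (hz u hu).
  replace (Derive (f_profile delta C l1 k1) u) with 0; [ring|].
  symmetry; rewrite <- (Derive_const 0 u).
  apply Derive_ext_loc; generalize (oint_open a b u hu); apply filter_imp.
  intros s hs; rewrite (proj1 (hprof s hs)); exact (hz s hs).
- exists (fun s => hyp_angle (x (s + s0)) (y (s + s0))),
    (fun s => hyp_radius (x (s + s0)) (y (s + s0))); split.
  + intros s hs; rewrite (proj1 (hf s hs)); split; intros h.
    * destruct (hyp_polar_timelike _ _ h) as [<- <-]; reflexivity.
    * destruct (hyp_polar_spacelike _ _ h) as [<- <-]; reflexivity.
  + exact (cylinder_hyperbolic_polar a b x y delta C s0 l k hx hy hdelta hC hA hf).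
Qed.
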